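(* Let $n\geq 1$, let $X=(x_{st})_{n\times n}$ be an $n\times n$ matrix over $\mathbb{C}$, and let $m$ be the number of non-zero entries of $X$. For $1\leq i,j\leq n$ let $X_{ij}$ denote the matrix obtained from $X$ by replacing its $(i,j)$-entry $x_{ij}$ by $0$. Let $I=\{(i,j)\mid x_{ij}\neq 0,\ 1\leq i,j\leq n\}$. Then \[ (m-n)\,{\rm per}(X)=\sum_{(i,j)\in I}{\rm per}(X_{ij}), \] where ${\rm per}(Y)=\sum_{\alpha\in S_n}y_{1\alpha(1)}y_{2\alpha(2)}\cdots y_{n\alpha(n)}$ is the permanent of an $n\times n$ matrix $Y=(y_{st})$. *)

(* Defs.v *)
From mathcomp Require Import all_boot all_fingroup all_algebra.

Set Implicit Arguments.
Unset Strict Implicit.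
Unset Printing Implicit Defensive.

Import GRing.Theory.
Local Open Scope ring_scope.

Definition permanent (K : comNzRingType) (n : nat) (Y : 'M[K]_n) : K :=
  \sum_(s : 'S_n) \prod_(i < n) Y i (s i).

Definition zero_entry (K : nzRingType) (n : nat) (X : 'M[K]_n) (i j : 'I_n)
    : 'M[K]_n :=
  \matrix_(s, t) (if (s == i) && (t == j) then 0 else X s t).

Definition nz_entries (K : nzRingType) (n : nat) (X : 'M[K]_n)
    : {set 'I_n * 'I_n} :=
  [set ij | X ij.1 ij.2 != 0].

(* Main.v *)
(** Expand every permanent over 'S_n. The term of s in per (X_ij) is 0 if
    s i = j and the term of s in per X otherwise. A nonzero term of s has its n
    positions (i, s i) all in I, so it survives in exactly m - n of the
    per (X_ij). *)
Require Import Defs.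
From mathcomp Require Import all_boot all_order all_fingroup all_algebra.
From mathcomp Require Import reals complex.

Set Implicit Arguments.
Unset Strict Implicit.
Unset Printing Implicit Defensive.

Import GRing.Theory.
Local Open Scope ring_scope.

(** If [s i = j], the erased entry is a factor; otherwise the product never meets it. The subtracted
    form lets [sumrB] split the sum over positions into a constant part and a correction. *)
Lemma prod_zero_entry (K : comNzRingType) (n : nat) (X : 'M[K]_n)
    (s : 'S_n) (i j : 'I_n) :
  \prod_k zero_entry X i j k (s k) =
    \prod_k X k (s k) - (if s i == j then \prod_k X k (s k) else 0).
Proof.
case: eqVneq => [sij | nsij].
  by rewrite subrr (bigD1 i) //= mxE eqxx sij eqxx mul0r.
rewrite subr0; apply: eq_bigr => k _; rewrite mxE.
by case: eqVneq => [-> | //]; rewrite (negPf nsij).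
Qed.

(** Split by rows: in row [i] only the column [s i] passes the test, so each of the [n] rows
    contributes one copy of the product. *)
Lemma sum_nz_entries_on_perm (K : comNzRingType) (n : nat) (X : 'M[K]_n)
    (s : 'S_n) :
  \sum_(ij in nz_entries X) (if s ij.1 == ij.2 then \prod_k X k (s k) else 0) =
    n%:R * \prod_k X k (s k).
Proof.
rewrite -big_mkcondr /=.
under eq_bigl => ij do rewrite inE.
rewrite -(pair_big_dep xpredT (fun i j => (X i j != 0) && (s i == j))
           (fun _ _ => \prod_k X k (s k))) /=.
transitivity (\sum_(i < n) \prod_k X k (s k)); last first.
  by rewrite sumr_const card_ord mulr_natl.
apply: eq_bigr => i _.
(* If [X i (s i)] is 0, row [i] has no admissible column, but the product itself vanishes, so the
   row still contributes one copy of it. *)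
have [X0 | Xn0] := eqVneq (X i (s i)) 0.
  have -> : \prod_k X k (s k) = 0 by rewrite (bigD1 i) //= X0 mul0r.
  by rewrite big1.
rewrite (big_pred1 (s i)) // => j /=.
by rewrite (eq_sym (s i)); case: (eqVneq j) => [-> | _]; rewrite ?Xn0 ?andbF.
Qed.

Lemma sum_permanent_zero_entry (K : comNzRingType) (n : nat) (X : 'M[K]_n) :
  \sum_(ij in nz_entries X) permanent (zero_entry X ij.1 ij.2) =
    (#|nz_entries X|%:R - n%:R) * permanent X.
Proof.
rewrite exchange_big /= mulr_sumr; apply: eq_bigr => s _.
under eq_bigr => ij _ do rewrite prod_zero_entry.
by rewrite sumrB sum_nz_entries_on_perm sumr_const mulrBl !mulr_natl.
Qed.

Theorem theorem2p3 (R : realType) (n : nat) (hn : (1 <= n)%N)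
    (X : 'M[R[i]]_n) :
  (#|nz_entries X|%:R - n%:R) * permanent X =
    \sum_(ij in nz_entries X) permanent (zero_entry X ij.1 ij.2).
Proof. by rewrite sum_permanent_zero_entry. Qed.
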